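(* Let $p$ be a prime, $q=p^e$, $m,k\ge1$, and let $f\in\mathbb{F}_{q^m}[x_1,\dots,x_k]$ be a polynomial of degree $d$. Then \[\nu_p\big(N(f=y^q-y)\big)\ge\Big\lceil\frac{emk}{W_p(d,\mathbb{F}_{q^m}^k)}\Big\rceil,\] where $W_p(d,\mathbb{F}_{q^m}^k)=\max\{S_p(t_1)+\cdots+S_p(t_k):\boldsymbol{t}=(t_1,\dots,t_k)\in[0,q^m-1]^k,\ |\boldsymbol{t}|\le d\}$.
   Context: $N(f=y^q-y)$ denotes the number of $(x_1,\dots,x_k,y)\in\mathbb{F}_{q^m}^{k+1}$ with $f(x_1,\dots,x_k)=y^q-y$; $\nu_p$ is the $p$-adic valuation; $S_p(a)$ is the sum of the base-$p$ digits of $a$; $|\boldsymbol{t}|=\sum t_i$. *)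

(* Defs.v *)
From HB Require Import structures.
From mathcomp Require Import all_boot all_order all_algebra all_field.
From mathcomp Require Import mpoly.
Set Implicit Arguments. Unset Strict Implicit. Unset Printing Implicit Defensive.

(* Sum of the base-p digits of a, S_p(a); the fuel a suffices since p >= 2. *)
Fixpoint digsum_aux (fuel p a : nat) : nat :=
  match fuel with
  | 0 => 0
  | S f => if a is 0 then 0 else a %% p + digsum_aux f p (a %/ p)
  end.
Definition S_p (p a : nat) : nat := digsum_aux a p a.

Definition W_p (p d : nat) (F : finType) (k : nat) : nat :=
  \max_(t : {ffun 'I_k -> 'I_#|F|} | (\sum_i (t i : nat) <= d)%N)
     \sum_i S_p p (t i).

Definition Ncount (F : finFieldType) (k q : nat) (f : {mpoly F[k]}) : nat :=
  #|[set u : {ffun 'I_k -> F} * F | (f.@[u.1] == u.2 ^+ q - u.2)%R]|.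

Definition ceil_div (a b : nat) : nat := (a + b - 1) %/ b.

(* Main.v *)
(* Orthogonality of additive characters turns N into a sum, over certain a in
   F, of the character sums of psi(a f), psi taking values in the p-th roots
   of unity. As function of x in F^k, f has functional degree at most w = W_p
   p d F k: more than w successive differences kill it, since x^(p^j) is
   additive. Each difference of psi(a f) thus gains 1/w in divisibility by pi
   = zeta_p - 1. Summing over a line of F^k amounts to applying p - 1
   differences modulo p, and p is associated to pi^(p-1); hence summing over
   the emk lines spanned by an F_p-basis of F^k gives divisibility by
   pi^ceil(emk(p-1)/w), that is by p^(emk/w). *)
Require Import Defs.
From HB Require Import structures.
From mathcomp Require Import all_boot all_order all_algebra all_field.
From mathcomp Require Import mpoly zify.

Set Implicit Arguments. Unset Strict Implicit. Unset Printing Implicit Defensive.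
Import Order.TTheory GRing.Theory Num.Theory.
Local Open Scope ring_scope.

(** * Finite differences and functional degree *)

Definition fdiff (V W : zmodType) (a : V) (g : V -> W) : V -> W :=
  fun x => g (x + a) - g x.

Lemma fdiffM (V : zmodType) (R : pzRingType) (a : V) (g h : V -> R) x :
  fdiff a (fun x => g x * h x) x =
  fdiff a g x * h x + g x * fdiff a h x + fdiff a g x * fdiff a h x.
Proof.
rewrite /fdiff; move: (g (x + a)) (g x) (h (x + a)) (h x) => g1 g0 h1 h0.
rewrite -addrA -mulrDl [g0 + _]addrC subrK mulrBl mulrBr [X in _ = X]addrC.
by rewrite addrA subrK.
Qed.

Lemma sum_bin_lt (l n : nat) : (\sum_(i < n) 'C(i, l) = 'C(n, l.+1))%N.
Proof.
elim: n => [|n IHn]; first by rewrite big_ord0 bin0n.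
by rewrite big_ord_recr /= IHn binS addnC.
Qed.

(** Newton's forward difference formula, by Pascal's rule. The bound [M] is decoupled from [n] so
    that all points of a line are expanded over one range of [l]. *)
Lemma fdiff_taylor (V : zmodType) (R : pzRingType) (a : V) (H : V -> R) M n x :
  (n < M)%N ->
  H (x + a *+ n) = \sum_(l < M) iter l (fdiff a) H x *+ 'C(n, l).
Proof.
elim: n M x => [|n IHn] [|M] x // ltnM.
  rewrite big_ord_recl big1 => [|i _]; last by rewrite bin0n.
  by rewrite /= bin0 mulr0n mulr1n !addr0.
rewrite mulrS addrA (IHn M) // [RHS]big_ord_recl /= bin0 mulr1n.
under [X in _ = _ + X]eq_bigr => i _ do rewrite /bump /= add1n binS mulrnDr.
have step l : iter l (fdiff a) H (x + a) =
    iter l (fdiff a) H x + iter l.+1 (fdiff a) H x.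
  by rewrite iterS [fdiff a _ x]/fdiff addrCA subrr addr0.
under eq_bigr => i _ do rewrite step mulrnDl.
rewrite !big_split /= addrA; congr (_ + _).
(* Both sides are the sum over [l < M.+1]: its last term vanishes since [n < M], its first is
   [H x]. *)
have := @big_ord_recl R 0 +%R M (fun l => iter l (fdiff a) H x *+ 'C(n, l)).
by rewrite big_ord_recr /= bin_small // mulr0n addr0 bin0 mulr1n => ->.
Qed.

(* Functions of functional degree at most [j]: polynomials of degree at most [j] in additive maps. *)
Inductive addpoly (V : zmodType) (F : pzRingType) : nat -> (V -> F) -> Prop :=
| addpoly_const j c : addpoly j (fun=> c)
| addpoly_additive (L : V -> F) : (forall x y, L (x + y) = L x + L y) -> addpoly 1 L
| addpoly_add j g h : addpoly j g -> addpoly j h -> addpoly j (fun x => g x + h x)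
| addpoly_mul i j g h : addpoly i g -> addpoly j h -> addpoly (i + j) (fun x => g x * h x)
| addpoly_le i j g : (i <= j)%N -> addpoly i g -> addpoly j g
| addpoly_ext j g h : g =1 h -> addpoly j g -> addpoly j h.

(** Induction on the construction, with the Leibniz rule [fdiffM] for products. Degree 0 stands
    apart because degrees are natural numbers. *)
Lemma addpoly_diff (V : zmodType) (F : pzRingType) (a : V) j (g : V -> F) :
  addpoly j g -> if j is i.+1 then addpoly i (fdiff a g) else fdiff a g =1 (fun=> 0).
Proof.
have z0 i : addpoly i (fun _ : V => 0 : F) by apply: addpoly_const.
elim=> {j g} [j c|L La|j g h gP IHg hP IHh|
  i j g h gP IHg hP IHh|i j g leij gP IHg|j g h eqgh gP IHg].
- have D0 : fdiff a (fun=> c) =1 (fun=> 0) by move=> x; rewrite /fdiff subrr.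
  case: j => //= j; apply: addpoly_ext (z0 j) => x; by rewrite D0.
- apply: addpoly_ext (addpoly_const _ _ (L a)) => x.
  by rewrite /fdiff La addrC addKr.
- have DE x : fdiff a g x + fdiff a h x = fdiff a (fun x => g x + h x) x.
    by rewrite /fdiff opprD addrACA.
  case: j {gP hP} IHg IHh => [|j] IHg IHh.
    by move=> x; rewrite -DE IHg IHh addr0.
  exact: addpoly_ext DE (addpoly_add IHg IHh).
- have DE x := esym (fdiffM a g h x).
  case: i gP IHg => [|i] gP IHg; case: j hP IHh => [|j] hP IHh.
  + by move=> x; rewrite -DE IHg IHh !(mul0r, mulr0, addr0).
  + apply: addpoly_ext (addpoly_mul gP IHh) => x.
    by rewrite -DE IHg !mul0r add0r addr0.
  + rewrite addn0; apply: addpoly_ext (addpoly_le _ (addpoly_mul IHg hP)) => [x|].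
      by rewrite -DE IHh !mulr0 !addr0.
    by rewrite addn0.
  rewrite addSn; apply: addpoly_ext DE _; apply: addpoly_add; first apply: addpoly_add.
  + exact: addpoly_mul IHg hP.
  + by apply: addpoly_le (addpoly_mul gP IHh); rewrite addnS.
  by apply: addpoly_le (addpoly_mul IHg IHh); rewrite leq_add2l.
- case: i leij gP IHg => [|i] leij gP IHg; case: j leij => [|j] leij //.
    by apply: addpoly_ext (z0 j) => x; rewrite IHg.
  exact: addpoly_le IHg.
have DE : fdiff a g =1 fdiff a h by move=> x; rewrite /fdiff !eqgh.
case: j {gP} IHg => [|j] IHg; first by move=> x; rewrite -DE IHg.
exact: addpoly_ext DE IHg.
Qed.

(** * Divisibility with algebraic integer quotients *)

Definition Adiv (x y : algC) := exists2 z, z \in Aint & y = x * z.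

Lemma Adiv0 x : Adiv x 0.
Proof. by exists 0; rewrite ?mulr0 ?rpred0. Qed.

Lemma Adiv1 y : y \in Aint -> Adiv 1 y.
Proof. by exists y; rewrite ?mul1r. Qed.

Lemma AdivD x y1 y2 : Adiv x y1 -> Adiv x y2 -> Adiv x (y1 + y2).
Proof.
by move=> [z1 Az1 ->] [z2 Az2 ->]; exists (z1 + z2); rewrite ?rpredD ?mulrDr.
Qed.

Lemma Adiv_sum (I : finType) x (g : I -> algC) :
  (forall i, Adiv x (g i)) -> Adiv x (\sum_i g i).
Proof.
by move=> gP; elim/big_ind: _ => [|u v|i _]; [apply: Adiv0 | apply: AdivD |].
Qed.

Lemma AdivM x1 x2 y1 y2 : Adiv x1 y1 -> Adiv x2 y2 -> Adiv (x1 * x2) (y1 * y2).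
Proof.
move=> [z1 Az1 ->] [z2 Az2 ->]; exists (z1 * z2); first exact: rpredM.
by rewrite mulrACA.
Qed.

Lemma AdivX x y n : Adiv x y -> Adiv (x ^+ n) (y ^+ n).
Proof. by move=> [z Az ->]; exists (z ^+ n); rewrite ?rpredX ?exprMn. Qed.

Lemma AdivNr x y : Adiv x y -> Adiv x (- y).
Proof. by move=> [z Az ->]; exists (- z); rewrite ?rpredN ?mulrN. Qed.

Lemma AdivNl x y : Adiv x y -> Adiv (- x) y.
Proof. by move=> [z Az ->]; exists (- z); rewrite ?rpredN ?mulrNN. Qed.

Lemma Adiv_prod (I : finType) (g h : I -> algC) :
  (forall i, Adiv (g i) (h i)) -> Adiv (\prod_i g i) (\prod_i h i).
Proof.
move=> ghP; elim/big_rec2: _ => [|i u v _ uv]; last exact: AdivM.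
exact/Adiv1/rpred1.
Qed.

Lemma Adiv_trans y x z : Adiv x y -> Adiv y z -> Adiv x z.
Proof.
move=> [u Au ->] [v Av ->]; exists (u * v); first exact: rpredM.
by rewrite mulrA.
Qed.

Lemma Adiv_exp_le x y m n : x \in Aint -> (m <= n)%N ->
  Adiv (x ^+ n) y -> Adiv (x ^+ m) y.
Proof.
move=> Ax lemn; apply: Adiv_trans; exists (x ^+ (n - m)); first exact: rpredX.
by rewrite -exprD subnKC.
Qed.

(** For [m > 0] the quotient is rational and an algebraic integer, hence an integer. *)
Lemma Adiv_nat (m n : nat) : Adiv m%:R n%:R -> (m %| n)%N.
Proof.
case=> z Az nE; have [m0|m_gt0] := posnP m.
  by move: nE; rewrite m0 mul0r => /eqP; rewrite pnatr_eq0 => /eqP ->.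
rewrite -dvdC_nat -[(_ %| _)%C]/(n%:R \in dvdC m%:R).
have m_neq0 : m%:R != 0 :> algC by rewrite pnatr_eq0 -lt0n.
apply/dvdCP; exists z; last by rewrite mulrC.
apply: Cint_rat_Aint => //; have -> : z = n%:R / m%:R by rewrite nE mulrC mulKf.
by rewrite rpred_div ?rpred_nat.
Qed.

(** * Divisibility gained by differences and by sums over lines *)

(** Kept as a list with repetitions, so that a sum over it is an iterated sum over lines. *)
Fixpoint nspan (V : zmodType) (p : nat) (b : seq V) : seq V :=
  if b is a :: b'
  then allpairs (fun (i : 'I_p) u => a *+ i + u) (index_enum 'I_p) (nspan p b')
  else [:: 0].

Section CharacterSums.
Variables (V : zmodType) (F : pzRingType) (psi : F -> algC) (pi : algC) (w : nat).
Hypotheses (Api : pi \in Aint) (psi0 : psi 0 = 1).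
Hypothesis (psiD : forall x y, psi (x + y) = psi x * psi y).
Hypothesis (psi_pi : forall x, Adiv pi (psi x - 1)).
Hypothesis (w_gt0 : (0 < w)%N).

(* An inductive lower bound: all iterated differences of order i of a function in [good j] are divisible by pi ^ ceil((i + j) / w). *)
Inductive good : nat -> (V -> algC) -> Prop :=
| good_const s c : Adiv (pi ^+ s) c -> good (w * s) (fun=> c)
| good_psi i j h : addpoly i h -> (i + j <= w)%N -> good j (fun x => psi (h x) - 1)
| good_add j G H : good j G -> good j H -> good j (fun x => G x + H x)
| good_mul i j G H : good i G -> good j H -> good (i + j) (fun x => G x * H x)
| good_le i j G : (i <= j)%N -> good j G -> good i G
| good_ext j G H : G =1 H -> good j G -> good j H.

Lemma good0 j : good j (fun=> 0).
Proof.
apply: (@good_le _ (w * j)); first by rewrite leq_pmull.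
exact/good_const/Adiv0.
Qed.

Lemma good_psi_poly h : addpoly w h -> good 0 (fun x => psi (h x)).
Proof.
move=> hP; apply: (@good_ext _ (fun x => (psi (h x) - 1) + 1)) => [x|].
  by rewrite subrK.
apply: good_add; first by apply: good_psi hP _; rewrite addn0.
rewrite -(muln0 w); apply: good_const; rewrite expr0; apply: Adiv1; exact: rpred1.
Qed.

(** The difference of [psi h - 1] is [psi h] times [psi (fdiff a h) - 1]: the degree lost by [h] is
    gained by the index [j]. Products follow from the Leibniz rule. *)
Lemma good_diff a j H : good j H -> good j.+1 (fdiff a H).
Proof.
elim=> {j H} [s c _|i j h hP le_w|j G H _ IHG _ IHH|
  i j G H GP IHG HP IHH|i j G leij _ IHG|j G H eqGH _ IHG].
- by apply: good_ext (good0 _) => x; rewrite /fdiff subrr.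
- have DE x : psi (h x) * (psi (fdiff a h x) - 1) = fdiff a (fun x => psi (h x) - 1) x.
    by rewrite mulrBr -psiD /fdiff mulr1 [h x + _]addrC subrK opprB addrA subrK.
  case: i hP le_w => [|i] hP le_w; have /= D := addpoly_diff a hP.
    by apply: good_ext (good0 _) => x; rewrite -DE D psi0 subrr mulr0.
  apply: good_ext DE _; rewrite -(add0n j.+1); apply: good_mul.
    by apply/good_psi_poly/(addpoly_le _ hP)/(leq_trans _ le_w)/leq_addr.
  by apply: good_psi D _; rewrite addnS -addSn.
- apply: good_ext (good_add IHG IHH) => x.
  by rewrite /fdiff opprD addrACA.
- apply: good_ext (fun x => esym (fdiffM a G H x)) _.
  apply: good_add; first apply: good_add.
  + exact: good_mul IHG HP.
  + by rewrite -addnS; apply: good_mul.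
  by apply: good_le (good_mul IHG IHH); rewrite addSn addnS ltnS leqnSn.
- exact: good_le IHG.
by apply: good_ext IHG => x; rewrite /fdiff !eqGH.
Qed.

(** The condition [w * s < j + w] means [s <= ceil(j / w)]. Products work because this ceiling is
    subadditive in [j]. *)
Lemma good_Adiv j H x s : good j H -> (w * s < j + w)%N -> Adiv (pi ^+ s) (H x).
Proof.
move=> HP; elim: HP s => {j H} [r c cP|i j h hP le_w|j G H _ IHG _ IHH|
  i j G H _ IHG _ IHH|i j G leij _ IHG|j G H eqGH _ IHG] t.
- rewrite -mulnSr ltn_pmul2l // ltnS => ltts; exact: Adiv_exp_le cP.
(* Here [j <= w], so [t] is at most 1 and [psi_pi] suffices. *)
- move=> lt_t; have {lt_t} : (w * t < w * 2)%N.
    apply: leq_trans lt_t _; rewrite muln2 -addnn leq_add2r.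
    by rewrite (leq_trans _ le_w) ?leq_addl.
  rewrite ltn_pmul2l // ltnS => let1.
  by apply: Adiv_exp_le let1 _; rewrite ?expr1.
- by move=> lt_t; apply: AdivD; [apply: IHG | apply: IHH].
- move=> lt_t; pose a := ((i + w.-1) %/ w)%N; pose b := ((j + w.-1) %/ w)%N.
  have aP : (w * a < i + w)%N.
    by rewrite mulnC (leq_ltn_trans (leq_divM _ _)) // ltn_add2l prednK.
  have bP : (w * b < j + w)%N.
    by rewrite mulnC (leq_ltn_trans (leq_divM _ _)) // ltn_add2l prednK.
  (* a = ceil(i / w) and b = ceil(j / w) *)
  have le_t : (t <= a + b)%N.
    have := ltn_ceil (i + w.-1) w_gt0; have := ltn_ceil (j + w.-1) w_gt0.
    rewrite -/a -/b => ltb lta.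
    rewrite -ltnS -(ltn_pmul2l w_gt0); nia.
  apply: Adiv_exp_le le_t _ => //; rewrite exprD.
  by apply: AdivM; [apply: IHG | apply: IHH].
- by move=> lt_t; apply: IHG; apply: leq_trans lt_t _; rewrite leq_add2r.
by rewrite -eqGH; apply: IHG.
Qed.

Lemma good_iter a l j H : good j H -> good (j + l) (iter l (fdiff a) H).
Proof.
by move=> HP; elim: l => [|l IHl]; rewrite ?addn0 // addnS; apply: good_diff.
Qed.

Lemma good_sum (I : Type) (r : seq I) j (G : I -> V -> algC) :
  (forall i, good j (G i)) -> good j (fun x => \sum_(i <- r) G i x).
Proof.
move=> GP; elim: r => [|i r IHr].
  by apply: good_ext (good0 j) => x; rewrite big_nil.
by apply: good_ext (good_add (GP i) IHr) => x; rewrite big_cons.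
Qed.

Variable p : nat.
Hypotheses (p_pr : prime p) (pi_p : Adiv (pi ^+ p.-1) p%:R).

(** Newton expansion turns the sum into that of ['C(p, l.+1)] times the [l]-th difference, over
    [l < p]. For [l = p.-1] the coefficient is 1 and [p.-1] differences were taken; for smaller [l],
    [p] divides the coefficient and brings [pi ^+ p.-1]. *)
Lemma good_line a j H :
  good j H -> good (j + p.-1) (fun x => \sum_(i < p) H (x + a *+ i)).
Proof.
move=> HP; pose G (l : 'I_p) x := 'C(p, l.+1)%:R * iter l (fdiff a) H x.
apply: (@good_ext _ (fun x => \sum_l G l x)) => [x|].
  under [RHS]eq_bigr => i _ do rewrite (fdiff_taylor _ _ _ (ltn_ord i)).
  rewrite exchange_big /=; apply: eq_bigr => l _.
  by rewrite /G mulr_natl sumrMnr sum_bin_lt.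
apply: good_sum => l; rewrite /G.
have [lt_l|] := ltnP l p.-1; last first.
  move=> ge_l; have -> : nat_of_ord l = p.-1.
    by apply/eqP; rewrite eqn_leq ge_l andbT -ltnS prednK ?prime_gt0.
  rewrite prednK ?prime_gt0 // binn.
  by apply: good_ext (good_iter a p.-1 HP) => x; rewrite mul1r.
have /dvdnP[c ->] : (p %| 'C(p, l.+1))%N.
  by apply: prime_dvd_bin => //=; rewrite -ltn_predRL.
rewrite addnC; apply: good_mul; last first.
  by apply: good_le (good_iter a l HP); rewrite leq_addr.
apply: (@good_le _ (w * p.-1)); first by rewrite leq_pmull.
apply: good_const; rewrite natrM mulrC -[_ ^+ _]mulr1.
by apply: AdivM pi_p _; apply: Adiv1; apply: rpred_nat.
Qed.

Lemma good_nspan b j H :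
  good j H -> good (j + size b * p.-1) (fun x => \sum_(u <- nspan p b) H (x + u)).
Proof.
move=> HP; elim: b => [|a b IHb] /=.
  by rewrite addn0; apply: good_ext HP => x; rewrite big_seq1 addr0.
rewrite mulSn addnCA addnC; apply: good_ext (good_line a IHb) => x.
rewrite big_allpairs_dep /=; apply: eq_bigr => i _; apply: eq_bigr => u _.
by rewrite addrA.
Qed.

End CharacterSums.

(** * Roots of unity of prime order *)

Section PrimeRootsOfUnity.
Variables (p : nat) (z : algC).
Hypotheses (p_pr : prime p) (z_prim : p.-primitive_root z).

Lemma Aint_unity_root_sub1 : z - 1 \in Aint.
Proof. by rewrite rpredB ?rpred1 ?(Aint_prim_root z_prim). Qed.

Lemma Adiv_unity_root i : Adiv (z - 1) (z ^+ i - 1).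
Proof.
rewrite subrX1; exists (\sum_(j < i) z ^+ j) => //.
by rewrite rpred_sum // => j _; rewrite rpredX ?(Aint_prim_root z_prim).
Qed.

(* Bezout: z is itself a power of z ^ i. *)
Lemma unity_root_Adiv i : (0 < i < p)%N -> Adiv (z ^+ i - 1) (z - 1).
Proof.
case/andP=> i_gt0 lt_ip; have [a _] := Bezoutl i (prime_gt0 p_pr).
have -> : gcdn p i = 1%N.
  by apply/eqP; change (coprime p i); rewrite prime_coprime // gtnNdvd.
rewrite (prim_order_dvd z_prim) exprD expr1 => /eqP zE.
have Az := Aint_prim_root z_prim.
apply: (@Adiv_trans (z ^+ (a * i) - 1)).
  rewrite mulnC exprM (subrX1 (z ^+ i)); exists (\sum_(j < a) (z ^+ i) ^+ j) => //.
  by rewrite rpred_sum // => j _; rewrite !rpredX.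
by exists (- z); rewrite ?rpredN // mulrN mulrBl mul1r [_ * z]mulrC zE opprB.
Qed.

(** Cancel ['X - 1] in the factorisation of ['X^p - 1] and evaluate at 1. *)
Lemma prod_unity_root : \prod_(i < p.-1) (1 - z ^+ i.+1) = p%:R.
Proof.
have := factor_Xn_sub_1 z_prim; rewrite subrX1 big_ltn ?prime_gt0 //.
rewrite big_add1 big_mkord expr0 -polyC1 => /(mulfI (negbT (polyXsubC_eq0 1))).
move/(congr1 (horner^~ 1)); rewrite horner_prod horner_sum.
under eq_bigr do rewrite hornerXsubC.
by under [in RHS]eq_bigr do rewrite hornerXn expr1n; rewrite sumr_const card_ord.
Qed.

Lemma Adiv_prime : Adiv ((z - 1) ^+ p.-1) p%:R.
Proof.
rewrite -{1}(card_ord p.-1) -prodr_const -prod_unity_root; apply: Adiv_prod => i.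
by rewrite -[1 - _]opprB; apply/AdivNr/Adiv_unity_root.
Qed.

(** Converse of [Adiv_prime], needed to read divisibility by powers of [z - 1] back as divisibility
    by powers of [p]. *)
Lemma prime_Adiv : Adiv p%:R ((z - 1) ^+ p.-1).
Proof.
rewrite -{1}(card_ord p.-1) -prodr_const -prod_unity_root; apply: Adiv_prod => i.
rewrite -[1 - _]opprB; apply/AdivNl/unity_root_Adiv => /=.
by rewrite -ltn_predRL.
Qed.

End PrimeRootsOfUnity.

(** * Additive characters and bases over the prime field *)

(** Translation by [v0] permutes the terms and multiplies the sum by [chi v0]. *)
Lemma sum_hom_eq0 (V : finZmodType) (chi : V -> algC) (v0 : V) :
  (forall u v, chi (u + v) = chi u * chi v) -> chi v0 != 1 -> \sum_v chi v = 0.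
Proof.
move=> chiD chi_v0; apply/eqP.
have : \sum_v chi v = chi v0 * \sum_v chi v.
  rewrite {1}(reindex_inj (addrI v0)) mulr_sumr.
  by apply: eq_bigr => v _; rewrite chiD.
move/eqP; rewrite -{1}[\sum_v _]mul1r -subr_eq0 -mulrBl.
by rewrite mulf_eq0 subr_eq0 eq_sym (negPf chi_v0).
Qed.

Section PrimeCharacteristic.
Variables (p : nat) (F : finFieldType) (charFp : p \in [pchar F]).

(** Take [z] to the power of an ['F_p]-linear coordinate that does not vanish at 1. *)
Lemma exists_character (z : algC) : p.-primitive_root z ->
  exists psi : F -> algC,
    [/\ forall x, exists i, psi x = z ^+ i, psi 0 = 1,
        forall x y, psi (x + y) = psi x * psi y & psi 1 != 1].
Proof.
move=> z_prim; have p_pr : prime p := pcharf_prime charFp.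
pose K := pPrimeCharType charFp; pose X := vbasis {:K}.
have /existsP[j lam1] : [exists j, coord X j (1 : K) != 0].
  apply: contraT; rewrite negb_exists => /forallP c0.
  have /eqP := coord_vbasis (memvf (1 : K)).
  rewrite big1 ?oner_eq0 // => i _; move: (c0 i); rewrite negbK.
  by move=> /eqP->; rewrite scale0r.
(* Elements of ['F_p] are ordinals whose bound is [p] only up to this equation. *)
have pE : (Zp_trunc (pdiv p)).+2 = p by rewrite Fp_Zcast ?Zp_cast ?prime_gt1.
exists (fun x : F => z ^+ (coord X j (x : K) : 'F_p)); split.
- by move=> x; eexists.
- by rewrite linear0.
(* Coordinates add modulo [p], the order of [z]. *)
- move=> x y; rewrite linearD /= -exprD -(prim_expr_mod z_prim (_ + _)%N).
  by rewrite {3}pE.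
rewrite -(prim_order_dvd z_prim) gtnNdvd //; last first.
  by apply: leq_trans (ltn_ord _) _; rewrite pE.
by rewrite lt0n; apply: contraNneq lam1 => c0; apply/eqP/val_inj.
Qed.

Lemma mem_nspan (V : vectType 'F_p) (b : seq V) v : v \in <<b>>%VS -> v \in nspan p b.
Proof.
have p_pr : prime p := pcharf_prime charFp.
have pE : (Zp_trunc (pdiv p)).+2 = p by rewrite Fp_Zcast ?Zp_cast ?prime_gt1.
elim: b v => [|a b IHb] v; first by rewrite span_nil memv0 inE.
rewrite span_cons => /memv_addP[_ /vlineP[c ->] [u /IHb ub ->]].
have lt_cp : (c < p)%N by apply: leq_trans (ltn_ord _) _; rewrite pE.
apply/allpairsP; exists (Ordinal lt_cp, u); split=> //=; first exact: mem_index_enum.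
by rewrite -scaler_nat natr_Zp.
Qed.

Lemma size_nspan (V : zmodType) (b : seq V) : size (nspan p b) = (p ^ size b)%N.
Proof.
elim: b => //= a b IHb; rewrite size_allpairs IHb expnS; congr (_ * _)%N.
by rewrite -[index_enum _]enumT size_enum_ord.
Qed.

(** The combinations of an ['F_p]-basis reach every vector, and there are as many of them, [p ^ n],
    as vectors; so none repeats. *)
Lemma exists_nspan_basis (k n : nat) : (#|F| ^ k = p ^ n)%N ->
  exists2 b : seq {ffun 'I_k -> F},
    size b = n & perm_eq (nspan p b) (enum {ffun 'I_k -> F}).
Proof.
move=> cardE; have p_pr : prime p := pcharf_prime charFp.
pose V : vectType 'F_p := {ffun 'I_k -> pPrimeCharType charFp}.
have cardV : #|{ffun 'I_k -> F}| = (p ^ n)%N by rewrite card_ffun card_ord.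
pose b : seq V := vbasis {:V}.
have bP v : v \in nspan p b.
  by apply: mem_nspan; rewrite (span_basis (vbasisP _)) memvf.
have sz_b : size b = n.
  rewrite size_tuple; apply/(expnI (prime_gt1 p_pr)); rewrite -cardV.
  rewrite -[RHS](@card_vspacef 'F_p {ffun 'I_k -> pPrimeCharType charFp}
    (Vector.class V)).
  by rewrite card_vspace card_Fp.
exists b => //; apply: uniq_perm; last by move=> v; rewrite bP mem_enum.
  apply: leq_size_uniq (enum_uniq {ffun 'I_k -> F}) _ _ => [v _|]; first exact: bP.
  by rewrite size_nspan sz_b -cardE -cardT cardV cardE.
exact: enum_uniq.
Qed.

End PrimeCharacteristic.

(** * Functional degree of a polynomial *)

(* The least exponent inducing the same function as 'X^t on a field of Q elements. *)
Definition red_exp (Q t : nat) : nat := if t is t'.+1 then (t' %% Q.-1).+1 else 0%N.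

Lemma red_exp_le Q t : (red_exp Q t <= t)%N.
Proof. by case: t => //= t; rewrite ltnS leq_mod. Qed.

Lemma red_exp_lt Q t : (1 < Q)%N -> (red_exp Q t < Q)%N.
Proof.
by case: Q t => [|[|Q]] [|t] // _; rewrite /= ltnS ltn_mod.
Qed.

(** By [x ^+ #|F| = x], an exponent may drop by [#|F|.-1] as long as it stays positive; thus [x = 0]
    is no special case. *)
Lemma expr_red_exp (F : finFieldType) (x : F) t : x ^+ red_exp #|F| t = x ^+ t.
Proof.
case: t => //= t; rewrite [in RHS](divn_eq t #|F|.-1) -addnS exprD.
elim: (t %/ _)%N => [|c IHc]; first by rewrite mul0n mul1r.
rewrite mulSn exprD {1}IHc -mulrA mulrCA; congr (_ * _).
by rewrite exprS mulrA -exprSr prednK ?(ltnW (finNzRing_gt1 F)) // expf_card.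
Qed.

Section AddpolyEval.
Variables (p : nat) (F : finFieldType) (charFp : p \in [pchar F]).

Lemma addpoly_exp (V : zmodType) (L : V -> F) n :
  (forall x y, L (x + y) = L x + L y) -> addpoly n (fun x => L x ^+ n).
Proof.
move=> LD; elim: n => [|n IHn]; first exact: addpoly_const.
apply: addpoly_ext (addpoly_mul (addpoly_additive LD) IHn) => x.
by rewrite exprS.
Qed.

(* L^(p^j) is additive, so base-p digits make L^t a product of [S_p p t] additive maps. *)
Lemma addpoly_exp_S_p (V : zmodType) (L : V -> F) t :
  (forall x y, L (x + y) = L x + L y) -> addpoly (S_p p t) (fun x => L x ^+ t).
Proof.
move=> LD0; have p_pr : prime p := pcharf_prime charFp.
(* Any fuel [n >= t] is allowed, because the recursion lowers the fuel by one while [t] is divided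
   by [p]. *)
suff digsum n : (t <= n)%N -> addpoly (digsum_aux n p t) (fun x => L x ^+ t).
  exact: digsum (leqnn t).
elim: n t L LD0 => [|n IHn] [|t] L LD //= le_tn; try exact: addpoly_const.
(* By Frobenius [L ^+ p] is additive again and takes over the remaining digits. *)
have LpD x y : L (x + y) ^+ p = L x ^+ p + L y ^+ p.
  by rewrite LD exprDn_pchar // pnatE.
have le_n : (t.+1 %/ p <= n)%N.
  by rewrite -ltnS; apply: leq_trans le_tn; rewrite ltn_Pdiv ?prime_gt1.
apply: addpoly_ext (addpoly_mul (addpoly_exp (t.+1 %% p) LD) (IHn _ _ LpD le_n)).
by move=> x; rewrite -exprM -exprD addnC mulnC -divn_eq.
Qed.

Lemma addpoly_prod (V : zmodType) (I : Type) (r : seq I)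
    (D : I -> nat) (G : I -> V -> F) :
  (forall i, addpoly (D i) (G i)) ->
  addpoly (\sum_(i <- r) D i) (fun x => \prod_(i <- r) G i x).
Proof.
move=> GP; elim: r => [|i r IHr].
  by apply: addpoly_ext (addpoly_const _ _ 1) => x; rewrite big_nil.
by rewrite big_cons; apply: addpoly_ext (addpoly_mul (GP i) IHr) => x; rewrite big_cons.
Qed.

Lemma addpoly_sum (V : zmodType) (I : eqType) (r : seq I) j (G : I -> V -> F) :
  (forall i, i \in r -> addpoly j (G i)) ->
  addpoly j (fun x => \sum_(i <- r) G i x).
Proof.
elim: r => [|i r IHr] GP.
  by apply: addpoly_ext (addpoly_const _ _ 0) => x; rewrite big_nil.
have /IHr IH : forall i, i \in r -> addpoly j (G i).
  by move=> i' ri'; apply: GP; rewrite inE ri' orbT.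
by apply: addpoly_ext (addpoly_add (GP i (mem_head i r)) IH) => x; rewrite big_cons.
Qed.

Lemma addpoly_meval (k d : nat) (f : {mpoly F[k]}) : (msize f <= d.+1)%N ->
  addpoly (W_p p d F k) (fun x : {ffun 'I_k -> F} => f.@[x]).
Proof.
move=> deg_f; have Q_gt1 := finNzRing_gt1 F.
apply: addpoly_ext (fun x => esym (mevalE _ _)) _; apply: addpoly_sum => m fm.
rewrite -(add0n (W_p _ _ _ _)); apply: addpoly_mul; first exact: addpoly_const.
(* Reduced exponents lie in the index range of [W_p], and reduction does not raise their sum. *)
pose t := [ffun i : 'I_k => Ordinal (red_exp_lt (m i) Q_gt1)].
apply: (@addpoly_le _ _ (\sum_i S_p p (t i))).
  apply: (@leq_bigmax_cond _ _ (fun t : {ffun 'I_k -> 'I_#|F|} => \sum_i S_p p (t i))%N).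
  rewrite -ltnS; apply: leq_trans deg_f; apply: leq_ltn_trans (msize_mdeg_lt fm).
  by rewrite mdegE; apply: leq_sum => i _; rewrite ffunE red_exp_le.
have eval_addpoly i : addpoly (S_p p (t i)) (fun x : {ffun 'I_k -> F} => x i ^+ t i).
  by apply: addpoly_exp_S_p => x y; rewrite ffunE.
apply: addpoly_ext (addpoly_prod _ eval_addpoly) => x.
by apply: eq_bigr => i _; rewrite ffunE expr_red_exp.
Qed.

End AddpolyEval.

(** * Counting solutions by character sums *)

Lemma ceil_divP (n w : nat) :
  (0 < w)%N -> forall l, (ceil_div n w <= l)%N = (n <= l * w)%N.
Proof.
move=> w_gt0 l; rewrite /ceil_div -ltnS ltn_divLR // mulSn.
by rewrite addnC; lia.
Qed.

Section Counting.
Variables (p k n d : nat) (F : finFieldType) (f : {mpoly F[k]}) (L : F -> F).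
Hypotheses (charFp : p \in [pchar F]) (cardF : (#|F| ^ k = p ^ n)%N).
Hypotheses (deg_f : (msize f <= d.+1)%N) (LD : forall x y, L (x + y) = L x + L y).

Let w := W_p p d F k.
Let N := #|[set u : {ffun 'I_k -> F} * F | f.@[u.1] == L u.2]|.

(** Orthogonality detects [f.@[x] = L y]. As [L] is additive, so is the exponent in [y]: the sum of
    [psi (a * - L y)] over [y] is [#|F|] if all values are 1, and 0 otherwise. *)
Lemma character_count (psi : F -> algC) :
  psi 0 = 1 -> (forall x y, psi (x + y) = psi x * psi y) -> psi 1 != 1 ->
  N%:R = \sum_(a | [forall y, psi (a * - L y) == 1])
    \sum_(x : {ffun 'I_k -> F}) psi (a * f.@[x]).
Proof.
move=> psi0 psiD psi1.
have F_neq0 : #|F|%:R != 0 :> algC.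
  by rewrite pnatr_eq0 -lt0n; apply: ltnW (finNzRing_gt1 F).
have orth z : \sum_a psi (a * z) = if z == 0 then #|F|%:R else 0.
  have [->|z_neq0] := eqVneq z 0.
    by under eq_bigr do rewrite mulr0 psi0; rewrite sumr_const.
  (* At [a = z^-1] the character takes the value [psi 1], which is not 1. *)
  apply: (@sum_hom_eq0 _ _ z^-1) => [a b|]; first by rewrite mulrDl psiD.
  by rewrite mulVf.
apply: (mulIf F_neq0); rewrite mulr_suml.
transitivity (\sum_(u : {ffun 'I_k -> F} * F) \sum_a psi (a * (f.@[u.1] - L u.2))).
  under eq_bigr do rewrite orth subr_eq0.
  rewrite -big_mkcond /= sumr_const mulr_natl; congr (_ *+ _).
  by apply: eq_card => u; rewrite inE.
rewrite exchange_big /= [RHS]big_mkcond; apply: eq_bigr => a _.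
rewrite -(pair_bigA _ (fun (x : {ffun 'I_k -> F}) (y : F) =>
   psi (a * (f.@[x] - L y)))) /=.
under eq_bigr do under eq_bigr do rewrite mulrDr psiD.
under eq_bigr do rewrite -mulr_sumr.
rewrite -mulr_suml; case: ifPn => [/forallP triv | /forallPn[y psi_y]].
  congr (_ * _); under eq_bigr => y do rewrite (eqP (triv y)).
  by rewrite sumr_const.
rewrite (@sum_hom_eq0 _ (fun y => psi (a * - L y)) y) ?mulr0 // => u v.
by rewrite LD opprD mulrDr psiD.
Qed.

Lemma dvdn_count : (p ^ ceil_div n w %| N)%N.
Proof.
have p_pr : prime p := pcharf_prime charFp.
(* Division by 0 yields 0, so the claim for [w = 0] is divisibility by 1. *)
have [->|w_gt0] := posnP w; first by rewrite /ceil_div divn0 dvd1n.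
have [->|N_gt0] := posnP N; first exact: dvdn0.
have [z z_prim] := C_prim_root_exists (prime_gt0 p_pr).
have [psi [psi_z psi0 psiD psi1]] := exists_character charFp z_prim.
pose pi := z - 1; have Api : pi \in Aint := Aint_unity_root_sub1 z_prim.
have psi_pi x : Adiv pi (psi x - 1).
  by have [i ->] := psi_z x; exact: Adiv_unity_root z_prim i.
have pi_p := Adiv_prime p_pr z_prim; have p_pi := prime_Adiv p_pr z_prim.
(* Each of the [n] basis vectors yields a line sum worth [p.-1], and [w] of these units make one
   factor [pi]. *)
pose s := ceil_div (n * p.-1) w.
have s_lt : (w * s < n * p.-1 + w)%N.
  rewrite mulnC; apply: leq_ltn_trans (leq_divM _ _) _.
  by rewrite subn1 prednK // addn_gt0 w_gt0 orbT.
have pi_N : Adiv (pi ^+ s) N%:R.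
  rewrite (character_count psi0 psiD psi1) big_mkcond; apply: Adiv_sum => a.
  case: ifP => _; last exact: Adiv0.
  have [b sz_b b_perm] := exists_nspan_basis charFp cardF.
  have fP : addpoly w (fun x : {ffun 'I_k -> F} => a * f.@[x]).
    rewrite -(add0n w); apply: addpoly_mul (addpoly_meval charFp deg_f).
    exact: addpoly_const.
  have H0 := good_psi_poly psi pi fP.
  have := good_Adiv Api psi_pi w_gt0 0 (good_nspan psi0 psiD w_gt0 p_pr pi_p b H0).
  rewrite sz_b add0n => /(_ s s_lt); rewrite (perm_big _ b_perm) /= big_enum /=.
  by under eq_bigr do rewrite add0r.
(* The power [p.-1] turns [pi ^+ s] into an associate of [p ^ s], which brings the divisibility back
   to natural numbers. *)
have : (p ^ s %| N ^ p.-1)%N.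
  apply: Adiv_nat; rewrite !natrX; apply: Adiv_trans (AdivX p.-1 pi_N).
  by rewrite -exprM mulnC exprM; apply: AdivX.
(* Now [s <= p.-1 * logn p N]; unfolding both ceilings, the factor [p.-1] cancels. *)
rewrite pfactor_dvdn ?expn_gt0 ?N_gt0 // lognX pfactor_dvdn // !ceil_divP //.
by rewrite mulnC -mulnA leq_pmul2l // -subn1 subn_gt0 prime_gt1.
Qed.

End Counting.

Theorem theorem5p7 (p e m k d : nat) (F : finFieldType) (f : {mpoly F[k]}) :
  prime p -> (0 < e)%N -> (0 < m)%N -> (0 < k)%N ->
  #|F| = expn (expn p e) m ->
  msize f = d.+1 -> (0 < d)%N ->
  (expn p (ceil_div (e * m * k) (W_p p d F k)) %| @Ncount F k (expn p e) f)%N.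
Proof.
move=> p_pr _ _ _ cardF deg_f _.
have cardF' : #|F| = (p ^ (e * m))%N by rewrite cardF expnM.
have charFp := card_finPcharP cardF' p_pr.
apply: (@dvdn_count _ _ _ _ _ _ (fun y => y ^+ (p ^ e) - y)) => //.
- by rewrite cardF' -expnM.
- by rewrite deg_f.
(* The map sending [y] to [y ^+ q - y] is additive by Frobenius. *)
by move=> x y; rewrite exprDn_pchar ?pnatX ?pnatE ?charFp // opprD addrACA.
Qed.
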